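(* Let $(E,\|\cdot\|)$ be a Banach lattice. Then the pair $(E_{\overline{M}},p_{\overline{M}})$ is a Banach lattice for every positive uniformly bounded subset $M$ of $E$.
   Context: All vector spaces are real. A norm on an ordered vector space is monotone if $0\le v\le w$ implies $\|v\|\le\|w\|$. A Banach lattice is a Riesz space (vector lattice) with a complete monotone norm. A positive subset $M$ of $E$ is a non-empty subset of the positive cone $E_+$; it is required that $0\notin\mathrm{co}(M)$ (convex hull). $M$ is uniformly bounded if $\sup\{\|m\|:m\in M\}<\infty$. For such $M$, a summable sequence $(t_j)_{j\ge1}\subset\mathbf{R}_+$ (non-negative reals with $\sum_j t_j<\infty$) and $(m_j)_{j\ge1}\subset M$, $\sum_{j=1}^\infty t_jm_j$ denotes the $\|\cdot\|$-limit in $E$ of the partial sums. Define $E_{\overline{M}}=\{v\in E : |v|\le\sum_{j=1}^\infty t_jm_j \text{ for a summable }(t_j)_j\subset\mathbf{R}_+\text{ and }(m_j)_j\subset M\}$, with the order induced from $E$, and for $v\in E_{\overline{M}}$, $p_{\overline{M}}(v)=\inf\{\sum_{j=1}^\infty t_j : |v|\le\sum_{j=1}^\infty t_jm_j \text{ for a summable }(t_j)_j\subset\mathbf{R}_+\text{ and }(m_j)_j\subset M\}$.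
   Formalization: ''Banach lattice'' is taken in the standard sense, with the norm of |v| also equal to the norm of v (in hypothesis and conclusion); with a norm monotone only on the positive cone, as literally defined, the claim is false because completeness can fail. *)

(* Defs.v *)
From HB Require Import structures.
From mathcomp Require Import all_boot all_order all_algebra.
From mathcomp Require Import all_classical all_reals all_analysis.

Set Implicit Arguments.
Unset Strict Implicit.
Unset Printing Implicit Defensive.

Import Order.TTheory GRing.Theory Num.Theory.
Import numFieldNormedType.Exports.

Local Open Scope classical_set_scope.
Local Open Scope ring_scope.

(* The order is a fresh field vle rather than the library's <= : the Hierarchy
   Builder rejects a structure joining Order.POrder and NormedModule, because
   NumDomain already inherits from both without a common join. *)
HB.mixin Record Lmodule_isOrdered (R : realType) V & GRing.Lmodule R V := {
  vle : rel V ;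
  vle_refl : reflexive vle ;
  vle_anti : antisymmetric vle ;
  vle_trans : transitive vle ;
  vleD2r : forall z x y : V, vle x y -> vle (x + z) (y + z) ;
  scalev_ge0 : forall (a : R) (x : V), 0 <= a -> vle 0 x -> vle 0 (a *: x)
}.

#[short(type="orderedLmodType")]
HB.structure Definition OrderedLmodule (R : realType) :=
  {V of GRing.Lmodule R V & Lmodule_isOrdered R V}.

(* Infima need not be postulated: v -> - v reverses the order. *)
HB.mixin Record OrderedLmodule_isRiesz (R : realType) V
    & OrderedLmodule R V := {
  vsup : V -> V -> V ;
  vsup_le : forall v w u : V, vle (vsup v w) u = vle v u && vle w u
}.

#[short(type="rieszType")]
HB.structure Definition Riesz (R : realType) :=
  {V of OrderedLmodule R V & OrderedLmodule_isRiesz R V}.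

Definition vabs (R : realType) (V : rieszType R) (v : V) : V := vsup v (- v).

(* Together the two axioms say that vle (vabs v) (vabs w) implies
   `|v| <= `|w|, i.e. that the norm is a lattice norm.  Monotonicity on the
   positive cone alone would not relate the norm of v to that of vabs v. *)
HB.mixin Record isLatticeNormed (R : realType) E
    & CompleteNormedModule R E & Riesz R E := {
  norm_monotone : forall v w : E, vle 0 v -> vle v w -> `|v| <= `|w| ;
  norm_vabs : forall v : E, `|vabs v| = `|v|
}.

#[short(type="banachLatticeType")]
HB.structure Definition BanachLattice (R : realType) :=
  {E of CompleteNormedModule R E & Riesz R E & isLatticeNormed R E}.

Definition convex_hull (R : realType) (V : lmodType R) (A : set V) : set V :=
  smallest (@convex_set R V) A.

Definition positive_subset (R : realType) (V : rieszType R) (M : set V) :=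
  [/\ M !=set0, (forall m, M m -> vle 0 m) & ~ convex_hull M 0].

Section EMbar.
Context (R : realType) (E : banachLatticeType R) (M : set E).

(* vabs v is below \sum_j t_j m_j for some t >= 0 with \sum_j t_j = c and some m
   valued in M; s is the norm limit of the vector-valued series. *)
Definition series_bound (v : E) (c : R) :=
  exists (t : R^nat) (m : nat -> E) (s : E),
    [/\ (forall j, 0 <= t j), (forall j, M (m j)),
        series t @ \oo --> c,
        series (fun j => t j *: m j) @ \oo --> s
      & vle (vabs v) s].

Definition EMbar : set E := [set v | exists c, series_bound v c].

Definition pMbar (v : E) : R := inf [set c | series_bound v c].

End EMbar.

(* The subset D of E with the linear structure and the order of E and the norm
   p is a Banach lattice: it is the image of one under a linear order embedding
   (injective by antisymmetry) carrying its norm to p. *)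
Definition banach_lattice_on (R : realType) (E : rieszType R)
    (D : set E) (p : E -> R) :=
  exists (F : banachLatticeType R) (i : {linear F -> E}),
    [/\ range i = D, (forall x y, vle (i x) (i y) = vle x y)
      & forall x, p (i x) = `|x|].

(* Main.v *)
From HB Require Import structures.
Require Import Defs.
From mathcomp Require Import all_boot all_order all_algebra.
From mathcomp Require Import all_classical all_reals all_analysis.
From mathcomp Require Import lra.

Set Implicit Arguments.
Unset Strict Implicit.
Unset Printing Implicit Defensive.

Import Order.TTheory GRing.Theory Num.Theory.
Import numFieldNormedType.Exports.

Local Open Scope classical_set_scope.
Local Open Scope ring_scope.

(** Write [p] for [pMbar M] and [D] for [EMbar M].  Everything rests on one
    closure property, [series_bound_series]: if [v n] is dominated with total
    weight [c n], if the [c n] are summable and if the series of the [v n]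
    converges in [E], then its sum is dominated with weight at most the sum of
    the [c n].  To see this, merge the countably many dominating series into one
    along an enumeration of [nat * nat].  The merged series converges because
    [M] is bounded, the weights are summable and [E] is complete.  Its sum
    exceeds every partial sum of the [n]-th dominating sums, because all terms
    are positive and the positive cone is closed ([ge0_cvg_ge0]).

    Padding two vectors with zeros gives stability of [D] under addition and the
    triangle inequality for [p].  Since a vector dominated with weight [c] has
    norm at most [B * c], where [B] bounds [M] ([series_bound_norm]), [p]
    vanishes at zero only.  That [D] is a sublattice and [p] a lattice norm is
    immediate, because both depend on [v] through [vabs v] only, and
    monotonically so.

    For completeness it suffices that series with summable norms converge
    ([normed_series_complete]).  If the [p (v n)] are summable, choose weights
    [c n <= p (v n) + 2^-n]; the series of the [v n] then converges in [E] since
    [`|v n| <= B * c n].  The closure property applied to its tails bounds the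
    [p]-distance from the partial sums to the limit by the tails of the series
    of the [c n] ([pMbar_series_cvg]). *)

(** * Ordered vector spaces and Riesz spaces *)

Section OrderedModule.
Context (R : realType) (V : orderedLmodType R).
Implicit Types (x y z t : V) (a : R).

Lemma subv_ge0 x y : vle 0 (y - x) = vle x y.
Proof.
by apply/idP/idP => [/(vleD2r x)|/(vleD2r (- x))]; rewrite ?add0r ?subrK ?subrr.
Qed.

Lemma vleD x y z t : vle x y -> vle z t -> vle (x + z) (y + t).
Proof.
move=> xy zt; apply: vle_trans (vleD2r z _ _ xy) _.
by rewrite ![y + _]addrC vleD2r.
Qed.

Lemma vleZ a x y : 0 <= a -> vle x y -> vle (a *: x) (a *: y).
Proof.
move=> a0; rewrite -subv_ge0 -(subv_ge0 (a *: x)) -scalerBr.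
exact: scalev_ge0.
Qed.

Lemma vleN x y : vle (- x) (- y) = vle y x.
Proof. by rewrite -subv_ge0 opprK addrC subv_ge0. Qed.

Lemma vle_sum (I : Type) (r : seq I) (P : pred I) (F G : I -> V) :
  (forall i, vle (F i) (G i)) ->
  vle (\sum_(i <- r | P i) F i) (\sum_(i <- r | P i) G i).
Proof.
move=> FG; elim/big_ind2: _ => // [|x x' y y']; first exact: vle_refl.
exact: vleD.
Qed.

Lemma sumv_ge0 (I : Type) (r : seq I) (P : pred I) (F : I -> V) :
  (forall i, vle 0 (F i)) -> vle 0 (\sum_(i <- r | P i) F i).
Proof.
move=> F0; elim/big_ind: _ => // [|x y x0 y0]; first exact: vle_refl.
by rewrite -(addr0 0); exact: vleD.
Qed.

End OrderedModule.

Section RieszSpace.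
Context (R : realType) (V : rieszType R).
Implicit Types (u v w : V) (a : R).

Lemma vle_supl v w : vle v (vsup v w).
Proof. by have := vle_refl (vsup v w); rewrite vsup_le => /andP[]. Qed.

Lemma vle_supr v w : vle w (vsup v w).
Proof. by have := vle_refl (vsup v w); rewrite vsup_le => /andP[]. Qed.

Lemma vabs_le v u : vle (vabs v) u = vle v u && vle (- v) u.
Proof. exact: vsup_le. Qed.

Lemma vle_abs v : vle v (vabs v).
Proof. exact: vle_supl. Qed.

Lemma vleN_abs v : vle (- v) (vabs v).
Proof. exact: vle_supr. Qed.

(** Both [v] and [- v] lie below [vabs v], hence so does half of their sum. *)
Lemma vabs_ge0 v : vle 0 (vabs v).
Proof.
have : vle 0 (vabs v + vabs v) by rewrite -(subrr v) vleD ?vle_abs ?vleN_abs.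
move=> /(scalev_ge0 (2^-1)); rewrite invr_ge0 ler0n => /(_ isT).
by rewrite scalerDr -scalerDl -[2^-1]mul1r -splitr scale1r.
Qed.

Lemma ger0_vabs v : vle 0 v -> vabs v = v.
Proof.
move=> v0; apply: vle_anti; rewrite vle_abs vabs_le vle_refl andbT.
by apply: vle_trans (v0); rewrite -[0]oppr0 vleN.
Qed.

Lemma vabs_vabs v : vabs (vabs v) = vabs v.
Proof. exact/ger0_vabs/vabs_ge0. Qed.

Lemma vabsD v w : vle (vabs (v + w)) (vabs v + vabs w).
Proof. by rewrite vabs_le opprD !vleD ?vle_abs ?vleN_abs. Qed.

Lemma vabs_sum (I : Type) (r : seq I) (F : I -> V) :
  vle (vabs (\sum_(i <- r) F i)) (\sum_(i <- r) vabs (F i)).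
Proof.
elim: r => [|i r IHr]; first by rewrite !big_nil ger0_vabs ?vle_refl.
by rewrite !big_cons; apply: vle_trans (vabsD _ _) _; rewrite vleD ?vle_refl.
Qed.

Lemma vabsZ_le a v : vle (vabs (a *: v)) (`|a| *: vabs v).
Proof.
rewrite vabs_le -scalerN; have [a0|/ltW a0] := lerP 0 a.
  by rewrite ger0_norm// !vleZ ?vle_abs ?vleN_abs.
rewrite ler0_norm// -[a *: v]opprK -scaleNr -scalerN.
rewrite -[a *: - v]opprK -scaleNr -scalerN opprK.
by rewrite !vleZ ?vle_abs ?vleN_abs ?oppr_ge0.
Qed.

Lemma vabs_sup_le v w : vle (vabs (vsup v w)) (vabs v + vabs w).
Proof.
rewrite vabs_le vsup_le; apply/andP; split; first apply/andP; first split.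
- by rewrite -[v in vle v _]addr0 vleD ?vle_abs ?vabs_ge0.
- by rewrite -[w in vle w _]add0r vleD ?vle_abs ?vabs_ge0.
- rewrite -[X in vle _ X]opprK vleN; apply: vle_trans (vle_supl v w).
  rewrite -[v in vle _ v]opprK vleN.
  by rewrite -[X in vle X _]addr0 vleD ?vleN_abs ?vabs_ge0.
Qed.

End RieszSpace.

(** * Limits in a Banach lattice *)

Section Limits.
Context (R : realType) (E : banachLatticeType R).
Implicit Types (u : nat -> E) (l x : E).

(** The positive cone is closed: the negative part of [l] is at most
    [vabs (l - u n)] as soon as [u n] is positive, so its norm is zero. *)
Lemma ge0_cvg_ge0 u l : (forall n, vle 0 (u n)) -> u @ \oo --> l -> vle 0 l.
Proof.
move=> u0 ul.
have bnd n : `|vsup (- l) 0| <= `|l - u n|.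
  rewrite -[leRHS]norm_vabs; apply: norm_monotone; first exact: vle_supr.
  rewrite vsup_le vabs_ge0 andbT; apply: vle_trans (vleN_abs _).
  by rewrite opprB -subv_ge0 opprK subrK.
have : `|vsup (- l) 0| <= 0.
  have c0 : `|l - u n| @[n --> \oo] --> (0 : R).
    rewrite -(normr0 E) -(subrr l); apply: cvg_norm; apply: cvgB => //.
    exact: cvg_cst.
  by apply: (ler_cvg_to (cvg_cst _) c0); near=> n; exact: bnd.
rewrite normr_le0 => /eqP s0.
by have := vle_supl (- l) 0; rewrite s0 -{1}oppr0 vleN.
Unshelve. all: by end_near. Qed.

Lemma vle_cvg u l x : (forall n, vle (u n) x) -> u @ \oo --> l -> vle l x.
Proof.
move=> ux ul; rewrite -subv_ge0; apply: (@ge0_cvg_ge0 (fun n => x - u n)).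
  by move=> n; rewrite subv_ge0.
by apply: cvgB => //; exact: cvg_cst.
Qed.

Lemma ge0_series_le u l n :
  (forall k, vle 0 (u k)) -> series u @ \oo --> l -> vle (series u n) l.
Proof.
move=> u0 ul; rewrite -subv_ge0.
apply: (@ge0_cvg_ge0 (fun k => series u (k + n)%N - series u n)).
  by move=> k; rewrite series_addn addrC addKr; exact: sumv_ge0.
by apply: cvgB; [rewrite (cvg_shiftn n (series u))|exact: cvg_cst].
Qed.

End Limits.

Lemma series_near_cst (K : numFieldType) (V : normedModType K)
    (u : nat -> V) N :
  (forall n, (N <= n)%N -> u n = 0) -> series u @ \oo --> series u N.
Proof.
move=> u0; apply: cvg_near_cst; near=> n.
have Nn : (N <= n)%N by near: n; exact: nbhs_infty_ge.
apply/eqP; rewrite -subr_eq0 sub_series_geq// big_nat_cond big1// => i.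
by rewrite andbT => /andP[/u0].
Unshelve. all: by end_near. Qed.

Lemma cvg_series_tail (K : numFieldType) (V : normedModType K)
    (u : nat -> V) (l : V) n :
  series u @ \oo --> l ->
  series (fun k => u (k + n)%N) @ \oo --> l - series u n.
Proof.
move=> ul.
have -> : series (fun k => u (k + n)%N) =
          fun k => series u (k + n)%N - series u n.
  apply/funext => k; rewrite series_addn addrC addKr seriesEnat /=.
  by rewrite -{2}[n]add0n big_addn addnK.
by apply: cvgB; [rewrite (cvg_shiftn n (series u))|exact: cvg_cst].
Qed.

(** A Cauchy filter contains balls of radius [2^-n] for every [n]; consecutive
    centres are at distance at most [2 * 2^-n], so the centres form a sequence
    whose telescoping series has summable norms.  Its limit is the limit of the
    filter. *)
Lemma normed_series_complete (R : realType) (V : normedModType R) :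
  (forall u : nat -> V, cvgn [normed series u] -> cvgn (series u)) ->
  forall F : set_system V, ProperFilter F -> cauchy F -> cvg F.
Proof.
move=> Vcvg F PF /cauchyP Fc.
have e0 n : 0 < (2^-1 : R) ^+ n by rewrite exprn_gt0 ?invr_gt0.
have [x Fx] := choice (fun n => Fc _ (e0 n)).
have xS n : `|telescope x n| <= geometric 2 (2^-1) n.
  (* Two members of a proper filter meet, which bounds the distance of the
     centres. *)
  have [y [/= + +]] := filter_ex (filterI (Fx n) (Fx n.+1)).
  rewrite -!ball_normE /= => xny xSny.
  rewrite /telescope /= (le_trans (ler_distD y _ _))// [`|y - _|]distrC.
  move: xny xSny (e0 n); rewrite exprS; lra.
have /Vcvg : cvgn [normed series (telescope x)].
  apply: (series_le_cvg _ _ xS) => // [n|]; first by rewrite mulr_ge0 ?ltW.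
  apply: is_cvg_geometric_series.
  by rewrite ger0_norm ?invf_lt1 ?ltr1n ?invr_ge0.
rewrite telescopeK => /cvg_ex[l xl].
have {xl} xl : x @ \oo --> l + x 0%N.
  have xE : (fun n => x n - x 0%N + x 0%N) = x.
    by apply/funext => n; rewrite subrK.
  by rewrite -{1}xE; apply: cvgD => //; exact: cvg_cst.
apply/cvg_ex; exists (l + x 0%N); apply/cvgrPdist_lt => e egt0.
have [n [xn en]] : exists n, `|l + x 0%N - x n| < e / 2 /\ (2^-1) ^+ n < e / 2.
  have h : 0 < e / 2 by lra.
  near \oo => n; exists n; split; near: n.
    by move/cvgrPdist_lt : xl; apply.
  have q1 : `|2^-1 : R| < 1 by rewrite ger0_norm ?invf_lt1 ?ltr1n ?invr_ge0.
  have /cvgrPdist_lt := cvg_expr q1; move=> /(_ _ h).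
  by apply: filterS => n; rewrite sub0r normrN ger0_norm ?ltW.
apply: filterS (Fx n) => y; rewrite -ball_normE /= => xny.
by rewrite (le_lt_trans (ler_distD (x n) _ _))//; lra.
Unshelve. all: by end_near. Qed.

(** * Rearranging double series *)

Lemma big_uniq_sub (V : nmodType) (I : eqType) (r s : seq I) (F : I -> V) :
  uniq r -> uniq s -> {subset r <= s} ->
  \sum_(i <- s) F i = \sum_(i <- r) F i + \sum_(i <- s | i \notin r) F i.
Proof.
move=> ur us rs; rewrite (bigID (mem r)) /=; congr (_ + _).
rewrite -big_filter; apply/perm_big/uniq_perm => //; first exact: filter_uniq.
by move=> i; rewrite mem_filter; case: (boolP (i \in r)) => // /rs.
Qed.

Section Enumeration.
Context (f : nat -> nat * nat).
Context (bijf : bijective f).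

Let head K := [seq f k | k <- iota 0 K].
Let rect N J := [seq (n, j) | n <- iota 0 N, j <- iota 0 J].

Let uniq_head K : uniq (head K).
Proof. by rewrite map_inj_uniq ?iota_uniq//; exact: bij_inj. Qed.

Let uniq_rect N J : uniq (rect N J).
Proof.
apply: allpairs_uniq => [||]; rewrite ?iota_uniq//.
by move=> -[? ?] [? ?] _ _ /= [-> ->].
Qed.

Let sum_head (V : zmodType) (F : nat * nat -> V) K :
  series (F \o f) K = \sum_(p <- head K) F p.
Proof. by rewrite seriesEnat /= big_map /index_iota subn0. Qed.

Let sum_rect (V : zmodType) (F : nat * nat -> V) N J :
  \sum_(0 <= n < N) series (fun j => F (n, j)) J = \sum_(p <- rect N J) F p.
Proof.
rewrite big_allpairs /index_iota subn0; apply: eq_bigr => n _.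
by rewrite seriesEnat /= /index_iota subn0.
Qed.

(** An initial segment of the enumeration and a rectangle are each contained in
    a large enough instance of the other.  The difference is kept as an explicit
    sum, so that both lemmas serve for real numbers and for vectors. *)
Lemma enum_sub_rect (V : zmodType) (F : nat * nat -> V) K : exists N,
  \sum_(0 <= n < N) series (fun j => F (n, j)) N =
  series (F \o f) K + \sum_(p <- rect N N | p \notin head K) F p.
Proof.
pose N := (\max_(k <- iota 0 K) maxn (f k).1 (f k).2).+1; exists N.
rewrite sum_head sum_rect; apply: big_uniq_sub => // _ /mapP[k kK ->].
have := leq_bigmax_seq (F := fun k => maxn (f k).1 (f k).2) k kK isT.
rewrite geq_max => /andP[k1 k2].
apply/allpairsP; exists (f k); rewrite !mem_iota /= !add0n !ltnS.
split=> //; last by case: (f k).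
Qed.

Lemma rect_sub_enum (V : zmodType) (F : nat * nat -> V) N J : exists K,
  series (F \o f) K =
  \sum_(0 <= n < N) series (fun j => F (n, j)) J +
  \sum_(p <- head K | p \notin rect N J) F p.
Proof.
have [g fK gK] := bijf.
pose K := (\max_(p <- rect N J) g p).+1; exists K.
rewrite sum_head sum_rect; apply: big_uniq_sub => // p pr.
rewrite -(gK p) map_f// mem_iota add0n ltnS /=.
exact: (leq_bigmax_seq (F := g) p pr isT).
Qed.

End Enumeration.

Lemma nat2_enum : exists f : nat -> nat * nat, bijective f.
Proof.
have /card_set_bijP[f] : ([set: nat] #= [set: nat * nat])%card.
  by rewrite card_eq_sym; exact: card_nat2.
by rewrite setTT_bijective; exists f.
Qed.

(** * Dominating series *)

(** Bundling the set with its properties lets the algebraic and topological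
    structures on the space it dominates be found by unification. *)
Record bounded_positive_set (R : realType) (E : banachLatticeType R) :=
  BoundedPositiveSet {
    bset :> set E;
    bset_neq0 : bset !=set0;
    bset_ge0 : forall m, bset m -> vle 0 m;
    bset_bounded : exists B, forall m, bset m -> `|m| <= B
  }.

Section Gauge.
Context (R : realType) (E : banachLatticeType R) (M : bounded_positive_set E).
Implicit Types (v w : E) (c : R).

Lemma bset_nonneg_bound : exists B : R,
  0 <= B /\ forall m, bset M m -> `|m| <= B.
Proof.
have [B MB] := bset_bounded M; exists B; split=> //.
by have [m /MB] := bset_neq0 M; exact: le_trans.
Qed.

Lemma series_bound_ge0 v c : series_bound M v c -> 0 <= c.
Proof.
move=> [t [m [s [t0 _ tc _ _]]]].
apply: (ler_cvg_to (cvg_cst 0) tc); near=> n.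
by rewrite /series /= sumr_ge0.
Unshelve. all: by end_near. Qed.

(** The inclusion of the dominated vectors into [E] is continuous. *)
Lemma series_bound_norm B v c : (forall m, bset M m -> `|m| <= B) ->
  series_bound M v c -> `|v| <= B * c.
Proof.
move=> MB [t [m [s [t0 Mm tc ts vs]]]].
rewrite -norm_vabs (le_trans (norm_monotone _ _ (vabs_ge0 v) vs))//.
apply: (ler_cvg_to (cvg_norm ts) (cvgM (cvg_cst B) tc)); near=> n.
rewrite /series /= mulr_sumr (le_trans (ler_norm_sum _ _ _))// ler_sum// => i _.
by rewrite normrZ ger0_norm// mulrC ler_wpM2r// MB//; exact: Mm.
Unshelve. all: by end_near. Qed.

Lemma series_bound_solid v w c :
  vle (vabs w) (vabs v) -> series_bound M v c -> series_bound M w c.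
Proof.
move=> wv [t [m [s [t0 Mm tc ts vs]]]]; exists t, m, s; split=> //.
exact: vle_trans vs.
Qed.

Lemma series_boundZ a v c :
  series_bound M v c -> series_bound M (a *: v) (`|a| * c).
Proof.
move=> [t [m [s [t0 Mm tc ts vs]]]].
exists (fun j => `|a| * t j), m, (`|a| *: s); split=> //.
- by move=> j; rewrite mulr_ge0.
- rewrite [series _](seriesZ (V := R^o) t); apply: cvgM => //.
  exact: cvg_cst.
- rewrite (_ : (fun j => _) = `|a| *: (fun j => t j *: m j)); last first.
    by apply/funext => j; rewrite -scalerA.
  by rewrite seriesZ; apply: cvgZ => //; exact: cvg_cst.
- by apply: vle_trans (vabsZ_le _ _) _; rewrite vleZ.
Qed.

Lemma series_bound0 : series_bound M 0 0.
Proof.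
have [m0 Mm0] := bset_neq0 M; exists (fun=> 0), (fun=> m0), 0.
have c0 (V : normedModType R) (u : nat -> V) :
    u = (fun=> 0) -> series u @ \oo --> (0 : V).
  move=> ->; rewrite (_ : series _ = fun=> 0); first exact: cvg_cst.
  by apply/funext => n; rewrite /series /= big1.
split=> //; first exact: c0.
- by apply: c0; apply/funext => j; rewrite scale0r.
- by rewrite ger0_vabs vle_refl.
Qed.

(** Every initial segment of the enumeration fits in a square, whose sum is at
    most the iterated sum. *)
Lemma enum_series_le (f : nat -> nat * nat) (t : nat -> nat -> R) (c : R^nat)
    C K :
  bijective f -> (forall n j, 0 <= t n j) ->
  (forall n, series (t n) @ \oo --> c n) -> series c @ \oo --> C ->
  series (fun k => t (f k).1 (f k).2) K <= C.
Proof.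
move=> bf t0 tc cC.
have le_lim (u : R^nat) l n : (forall k, 0 <= u k) -> series u @ \oo --> l ->
    series u n <= l.
  move=> u0 ul; rewrite -(cvg_lim _ ul)//; apply: nondecreasing_cvgn_le.
    exact: nondecreasing_series.
  by apply/cvg_ex; exists l.
have c0 n : 0 <= c n.
  by apply: le_trans (le_lim _ _ 0%N (t0 n) (tc n)); rewrite /series /= big_geq.
have [N tN] := enum_sub_rect bf (fun p => t p.1 p.2) K.
apply: le_trans (le_lim _ _ N c0 cC).
apply: (@le_trans _ _ (\sum_(0 <= n < N) series (t n) N)).
  by rewrite tN lerDl sumr_ge0.
by rewrite /series /= ler_sum// => n _; exact: le_lim.
Qed.

(** Each rectangle of positive terms is swallowed by an initial segment of the
    enumeration, hence lies below [S]; letting the rows grow gives the row sums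
    [s n]. *)
Lemma enum_series_ge (f : nat -> nat * nat) (a : nat -> nat -> E)
    (s : nat -> E) S N :
  bijective f -> (forall n j, vle 0 (a n j)) ->
  (forall n, series (a n) @ \oo --> s n) ->
  series (fun k => a (f k).1 (f k).2) @ \oo --> S ->
  vle (series s N) S.
Proof.
move=> bf a0 as_ aS.
apply: (@vle_cvg _ _ (fun J => \sum_(0 <= n < N) series (a n) J)) => [J|].
  have [K aK] := rect_sub_enum bf (fun p => a p.1 p.2) N J.
  apply: vle_trans (ge0_series_le K _ aS) => //; rewrite -subv_ge0.
  by rewrite [series _ K]aK addrC addKr sumv_ge0.
by apply: cvg_big => [|n _]; [exact: add_continuous|exact: as_].
Qed.

(** Countable additivity of domination.  The weight obtained is only bounded by
    [C], which is what estimates of an infimum require. *)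
Lemma series_bound_series (v : nat -> E) (c : R^nat) w C :
  (forall n, series_bound M (v n) (c n)) ->
  series c @ \oo --> C -> series v @ \oo --> w ->
  exists2 C', C' <= C & series_bound M w C'.
Proof.
move=> vc cC vw.
have [t /choice[m /choice[s tms]]] := choice vc.
have t0 n j : 0 <= t n j by have [] := tms n.
have Mm n j : bset M (m n j) by have [] := tms n.
have [f bf] := nat2_enum.
pose T k := t (f k).1 (f k).2; pose m' k := m (f k).1 (f k).2.
have T0 k : 0 <= T k by exact: t0.
have TC K : series T K <= C.
  by apply: (enum_series_le _ bf t0 _ cC) => n; have [] := tms n.
have /cvg_ex[C' TC'] : cvgn (series T).
  apply: nondecreasing_is_cvgn; first exact: nondecreasing_series.
  by exists C => _ [K _ <-].
exists C'.
  by apply: (ler_cvg_to TC' (cvg_cst C)); near=> K.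
have [B [B0 MB]] := bset_nonneg_bound.
have /cvg_ex[S TS] : cvgn (series (fun k => T k *: m' k)).
  apply: normed_cvg.
  apply: (@series_le_cvg _ _ (fun k => B * T k)) => //= [k|k|].
  - by rewrite mulr_ge0.
  - by rewrite normrZ ger0_norm// mulrC ler_wpM2r// MB//; exact: Mm.
  - by apply: is_cvg_seriesZ; apply/cvg_ex; exists C'.
exists T, m', S; split=> //; first by move=> k; exact: Mm.
have sS N : vle (series s N) S.
  apply: (@enum_series_ge f (fun n j => t n j *: m n j) s S N) => // [n j|n].
    by apply: scalev_ge0 => //; exact: bset_ge0.
  by have [] := tms n.
have vS N : vle (vabs (series v N)) S.
  apply: vle_trans (vabs_sum _ _) _; apply: vle_trans (sS N).
  by apply: vle_sum => n; have [] := tms n.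
rewrite vabs_le; apply/andP; split.
  by apply: (vle_cvg _ vw) => N; apply: vle_trans (vS N); exact: vle_abs.
apply: (vle_cvg (u := fun N => - series v N)) => [N|]; last exact: cvgN.
by apply: vle_trans (vS N); exact: vleN_abs.
Unshelve. all: by end_near. Qed.

(** A finite sum is a series that vanishes from some rank on. *)
Lemma series_boundD v w c d : series_bound M v c -> series_bound M w d ->
  exists2 e, e <= c + d & series_bound M (v + w) e.
Proof.
move=> vc wd.
have two (V : normedModType R) (x y : V) :
    series (nth 0 [:: x; y]) @ \oo --> x + y.
  have -> : x + y = series (nth 0 [:: x; y]) 2.
    by rewrite /series /= !big_nat_recr//= big_geq// add0r.
  by apply: series_near_cst => -[|[|n]] // _; rewrite /= nth_nil.
apply: series_bound_series (two R^o c d) (two E v w) => -[|[|n]] //=.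
by rewrite !nth_nil; exact: series_bound0.
Qed.

End Gauge.

Section GaugeNorm.
Context (R : realType) (E : banachLatticeType R) (M : bounded_positive_set E).
Implicit Types (v w : E) (c x : R).

Lemma pMbar_le v c : series_bound M v c -> pMbar M v <= c.
Proof. by apply: ge_inf; exists 0 => d; exact: series_bound_ge0. Qed.

Lemma le_pMbar v x : EMbar M v -> (forall c, series_bound M v c -> x <= c) ->
  x <= pMbar M v.
Proof. exact: lb_le_inf. Qed.

Lemma pMbar_lt v x : EMbar M v -> pMbar M v < x ->
  exists2 c, series_bound M v c & c < x.
Proof. exact: inf_lt. Qed.

Lemma pMbar_ge0 v : EMbar M v -> 0 <= pMbar M v.
Proof. by move/le_pMbar; apply => c; exact: series_bound_ge0. Qed.

Lemma EMbar_solid v w : vle (vabs w) (vabs v) -> EMbar M v -> EMbar M w.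
Proof. by move=> wv [c vc]; exists c; exact: series_bound_solid vc. Qed.

Lemma pMbar_solid v w : vle (vabs w) (vabs v) -> EMbar M v ->
  pMbar M w <= pMbar M v.
Proof.
move=> wv /le_pMbar; apply => c vc.
by apply: pMbar_le; exact: series_bound_solid vc.
Qed.

Lemma EMbarD v w : EMbar M v -> EMbar M w -> EMbar M (v + w).
Proof.
by move=> [c vc] [d wd]; have [e _ vwe] := series_boundD vc wd; exists e.
Qed.

Lemma EMbarZ a v : EMbar M v -> EMbar M (a *: v).
Proof. by move=> [c vc]; exists (`|a| * c); exact: series_boundZ. Qed.

Lemma EMbar_submod_closed : submod_closed [pred v | `[< EMbar M v >]].
Proof.
split=> [|a v w]; rewrite !inE; first by exists 0; exact: (series_bound0 M).
by move=> Mv Mw; apply: EMbarD => //; exact: EMbarZ.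
Qed.

Lemma pMbarD v w : EMbar M v -> EMbar M w ->
  pMbar M (v + w) <= pMbar M v + pMbar M w.
Proof.
move=> Mv Mw; rewrite -lerBlDr; apply: le_pMbar => // c vc.
rewrite lerBlDl -lerBlDr; apply: le_pMbar => // d wd.
rewrite lerBlDl; have [e ecd vwe] := series_boundD vc wd.
exact: le_trans (pMbar_le vwe) ecd.
Qed.

Lemma pMbarZ_le a v : EMbar M v -> pMbar M (a *: v) <= `|a| * pMbar M v.
Proof.
move=> Mv; have [->|a0] := eqVneq a 0.
  rewrite scale0r normr0 mul0r; apply: pMbar_le; exact: (series_bound0 M).
rewrite -ler_pdivrMl ?normr_gt0//; apply: le_pMbar => // c vc.
by rewrite ler_pdivrMl ?normr_gt0//; apply/pMbar_le/series_boundZ.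
Qed.

(** For [a] invertible the converse of [pMbarZ_le] is [pMbarZ_le] for the
    inverse of [a]. *)
Lemma pMbarZ a v : EMbar M v -> pMbar M (a *: v) = `|a| * pMbar M v.
Proof.
move=> Mv; apply/eqP; rewrite eq_le pMbarZ_le//=.
have [->|a0] := eqVneq a 0.
  by rewrite normr0 mul0r pMbar_ge0//; exact: EMbarZ.
rewrite -ler_pdivlMl ?normr_gt0// -normfV.
by rewrite -[v in leLHS](scalerK a0) pMbarZ_le//; exact: EMbarZ.
Qed.

Lemma pMbar_eq0 v : EMbar M v -> pMbar M v = 0 -> v = 0.
Proof.
move=> Mv v0; have [B [B0 MB]] := bset_nonneg_bound M.
apply/eqP; rewrite -normr_le0; apply/ler_addgt0Pr => e e0; rewrite add0r.
have h : pMbar M v < e / (B + 1) by rewrite v0 divr_gt0//; lra.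
have [c vc ce] := pMbar_lt Mv h.
have c0 := series_bound_ge0 vc.
rewrite (le_trans (series_bound_norm MB vc))//.
move: ce; rewrite ltr_pdivlMr; nra.
Qed.

(** Near-optimal weights [c n] make both the series of the [c n] and, through
    [series_bound_norm], that of the [v n] converge; the tails of the latter are
    dominated with weights at most the tails of the former. *)
Lemma pMbar_series_cvg (v : nat -> E) : (forall n, EMbar M (v n)) ->
  cvgn (series (pMbar M \o v)) ->
  exists2 w, EMbar M w & pMbar M (w - series v n) @[n --> \oo] --> (0 : R).
Proof.
move=> Mv pv.
have e0 n : 0 < (2^-1 : R) ^+ n by rewrite exprn_gt0 ?invr_gt0.
have /choice[c vc] : forall n, exists c,
    series_bound M (v n) c /\ c <= pMbar M (v n) + 2^-1 ^+ n.
  move=> n; have /pMbar_lt : pMbar M (v n) < pMbar M (v n) + 2^-1 ^+ n.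
    by rewrite ltrDl.
  by move=> /(_ (Mv n))[c vc /ltW]; exists c.
have c0 n : 0 <= c n by have [/series_bound_ge0] := vc n.
have /cvg_ex[C cC] : cvgn (series c).
  apply: (@series_le_cvg _ _ (pMbar M \o v + geometric 1 2^-1)) => //= [n|n|].
  - by rewrite addr_ge0 ?pMbar_ge0// mulr_ge0// ltW.
  - by have [_] := vc n; rewrite /GRing.add /= mul1r.
  - apply: is_cvg_seriesD => //; apply: is_cvg_geometric_series.
    by rewrite ger0_norm ?invf_lt1 ?ltr1n ?invr_ge0.
have [B [B0 MB]] := bset_nonneg_bound M.
have /cvg_ex[w vw] : cvgn (series v).
  apply: normed_cvg.
  apply: (@series_le_cvg _ _ (fun n => B * c n)) => //= [n|n|].
  - by rewrite mulr_ge0.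
  - by have [/(series_bound_norm MB)] := vc n.
  - by apply: is_cvg_seriesZ; apply/cvg_ex; exists C.
have tail n : exists2 C',
    C' <= C - series c n & series_bound M (w - series v n) C'.
  have cCn := cvg_series_tail (n := n) cC.
  apply: (series_bound_series _ cCn (cvg_series_tail (n := n) vw)) => k.
  by have [] := vc (k + n)%N.
have Mw n : EMbar M (w - series v n) by have [C' _] := tail n; exists C'.
exists w; first by have := Mw 0%N; rewrite /series /= big_geq// subr0.
apply: (@squeeze_cvgr _ _ _ _ (fun=> 0) (fun n => C - series c n)).
- near=> n; rewrite pMbar_ge0//=; have [C' C'C wC'] := tail n.
  exact: le_trans (pMbar_le wC') C'C.
- exact: cvg_cst.
- by rewrite -(subrr C); apply: cvgB => //; exact: cvg_cst.
Unshelve. all: by end_near. Qed.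

End GaugeNorm.

(** * The dominated subspace as a Banach lattice *)

Section EMbarSpace.
Context (R : realType) (E : banachLatticeType R) (M : bounded_positive_set E).

Definition in_EMbar : {pred E} := [pred v | `[< EMbar M v >]].

HB.instance Definition _ :=
  GRing.isSubmodClosed.Build R E in_EMbar (EMbar_submod_closed M).

Record EMbar_space := EMbarSpace { EMbar_val : E; _ : EMbar_val \in in_EMbar }.

HB.instance Definition _ := [isSub for EMbar_val].
HB.instance Definition _ := [Choice of EMbar_space by <:].
HB.instance Definition _ := [SubChoice_isSubLmodule of EMbar_space by <:].

Implicit Types x y z : EMbar_space.

Lemma EMbar_valP x : EMbar M (val x).
Proof. by apply/asboolP; exact: (valP x). Qed.

Lemma val_EMbar_space v : EMbar M v -> exists x, val x = v.
Proof. by move=> /asboolP Mv; exists (EMbarSpace Mv). Qed.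

Definition EMbar_norm x : R := pMbar M (val x).

Lemma EMbar_normD x y : EMbar_norm (x + y) <= EMbar_norm x + EMbar_norm y.
Proof. by rewrite /EMbar_norm raddfD pMbarD//; exact: EMbar_valP. Qed.

Lemma EMbar_normZ a x : EMbar_norm (a *: x) = `|a| * EMbar_norm x.
Proof. by rewrite /EMbar_norm linearZ pMbarZ//; exact: EMbar_valP. Qed.

Lemma EMbar_norm_eq0 x : EMbar_norm x = 0 -> x = 0.
Proof.
by move=> /(pMbar_eq0 (EMbar_valP x)) x0; apply/val_inj; rewrite x0 raddf0.
Qed.

HB.instance Definition _ :=
  Lmodule_isNormed.Build R EMbar_space EMbar_normD EMbar_normZ EMbar_norm_eq0.

Lemma EMbar_complete (F : set_system EMbar_space) :
  ProperFilter F -> cauchy F -> cvg F.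
Proof.
apply: normed_series_complete => u uc.
have [w /val_EMbar_space[x <-] uw] :=
  pMbar_series_cvg (fun n => EMbar_valP (u n)) uc.
apply/cvg_ex; exists x; apply/cvgrPdist_lt => e e0.
move/cvgrPdist_lt : uw => /(_ _ e0); apply: filterS => n; rewrite sub0r normrN.
apply: le_lt_trans; rewrite [leLHS]/Num.norm /= /EMbar_norm raddfB raddf_sum.
exact: ler_norm.
Qed.

HB.instance Definition _ := Uniform_isComplete.Build EMbar_space EMbar_complete.

Definition EMbar_vle : rel EMbar_space := fun x y => vle (val x) (val y).

Lemma EMbar_vle_refl : reflexive EMbar_vle.
Proof. by move=> x; exact: vle_refl. Qed.

Lemma EMbar_vle_anti : antisymmetric EMbar_vle.
Proof. by move=> x y /vle_anti/val_inj. Qed.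

Lemma EMbar_vle_trans : transitive EMbar_vle.
Proof. by move=> x y z; exact: vle_trans. Qed.

Lemma EMbar_vleD2r z x y : EMbar_vle x y -> EMbar_vle (x + z) (y + z).
Proof. by rewrite /EMbar_vle !raddfD; exact: vleD2r. Qed.

Lemma EMbar_scalev_ge0 a x : 0 <= a -> EMbar_vle 0 x -> EMbar_vle 0 (a *: x).
Proof. by rewrite /EMbar_vle raddf0 linearZ; exact: scalev_ge0. Qed.

HB.instance Definition _ := Lmodule_isOrdered.Build R EMbar_space
  EMbar_vle_refl EMbar_vle_anti EMbar_vle_trans EMbar_vleD2r EMbar_scalev_ge0.

(** The supremum taken in [E] stays dominated, since its absolute value is at
    most the sum of those of its arguments. *)
Lemma in_EMbar_sup x y : vsup (val x) (val y) \in in_EMbar.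
Proof.
have [[c xc] [d yd]] := (EMbar_valP x, EMbar_valP y).
apply/asboolP; apply: (@EMbar_solid _ _ _ (vabs (val x) + vabs (val y))).
  by apply: vle_trans (vabs_sup_le _ _) _; exact: vle_abs.
by apply: EMbarD; [exists c|exists d]; [move: xc|move: yd];
  apply: series_bound_solid; rewrite vabs_vabs vle_refl.
Qed.

Definition EMbar_sup x y : EMbar_space := EMbarSpace (in_EMbar_sup x y).

Lemma EMbar_sup_le x y z : vle (EMbar_sup x y) z = vle x z && vle y z.
Proof. exact: vsup_le. Qed.

HB.instance Definition _ :=
  OrderedLmodule_isRiesz.Build R EMbar_space EMbar_sup_le.

Lemma val_vabs x : val (vabs x) = vabs (val x).
Proof. by rewrite /vabs; have <- : val (- x) = - val x by exact: raddfN. Qed.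

Lemma EMbar_norm_monotone x y : vle 0 x -> vle x y -> `|x| <= `|y|.
Proof.
move=> x0 xy; apply: pMbar_solid (EMbar_valP y).
have x0' : vle 0 (val x) by rewrite -(raddf0 (val : EMbar_space -> E)).
by rewrite ger0_vabs//; apply: vle_trans (vle_abs _).
Qed.

Lemma EMbar_norm_vabs x : `|vabs x| = `|x|.
Proof.
apply/eqP; rewrite eq_le; apply/andP; split;
by apply: pMbar_solid (EMbar_valP _); rewrite val_vabs vabs_vabs vle_refl.
Qed.

HB.instance Definition _ :=
  isLatticeNormed.Build R EMbar_space EMbar_norm_monotone EMbar_norm_vabs.

End EMbarSpace.

Theorem theorem18 (R : realType) (E : banachLatticeType R) (M : set E) :
  positive_subset M -> bounded_set M ->
  banach_lattice_on (EMbar M) (pMbar M).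
Proof.
move=> [M_neq0 M_ge0 _] /pinfty_ex_gt0[B _ M_le].
have M_bounded : exists B, forall m, M m -> `|m| <= B by exists B => m /M_le.
pose M' := BoundedPositiveSet M_neq0 M_ge0 M_bounded.
exists (EMbar_space M'), (val : {linear EMbar_space M' -> E}); split=> //.
apply/seteqP; split=> [_ [x _ <-]|v /(@val_EMbar_space _ _ M')[x <-]].
  exact: (@EMbar_valP _ _ M' x).
by exists x.
Qed.
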